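(* Let $\mathcal F=[f_{i_1,\ldots,i_d}],\ \mathcal G=[g_{i_1,\ldots,i_d}]\in\mathbb R^{n^{\times d}}_{ps,+}$ and let $\alpha,\beta>0$ with $\alpha+\beta=1$. Then $$\rho(\mathcal F^{\circ\alpha}\circ\mathcal G^{\circ\beta})\le\rho(\mathcal F)^\alpha\rho(\mathcal G)^\beta.$$ Assume in addition that $\mathcal F^{\circ\alpha}\circ\mathcal G^{\circ\beta}$ is weakly irreducible, and let $u=(u_1,\dots,u_n)^\top>0$ and $v=(v_1,\dots,v_n)^\top>0$ be the positive eigenvectors of $\mathcal F$ and $\mathcal G$: $\mathcal F(u)=\rho(\mathcal F)u^{\circ(d-1)}$, $\mathcal G(v)=\rho(\mathcal G)v^{\circ(d-1)}$. Then the equality $\rho(\mathcal F^{\circ\alpha}\circ\mathcal G^{\circ\beta})=\rho(\mathcal F)^\alpha\rho(\mathcal G)^\beta$ holds if and only if there exists $a=(a_1,\dots,a_n)^\top>0$ such that $$f_{i_1,\ldots,i_d}u_{i_2}\cdots u_{i_d}=a_{i_1}g_{i_1,\ldots,i_d}v_{i_2}\cdots v_{i_d}\qquad\text{for all }i_1,\ldots,i_d\in[n].$$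
   Context: Let $n\ge1$, $d\ge3$ be integers, $[n]=\{1,\dots,n\}$. $\mathbb R^{n^{\times d}}_{ps,+}$ is the set of tensors $\mathcal T=[t_{i_1,\dots,i_d}]$, $i_1,\dots,i_d\in[n]$, with nonnegative real entries symmetric in the last $d-1$ indices. For $x\in\mathbb C^n$, $\mathcal T(x)_i=\sum_{i_2,\dots,i_d\in[n]}t_{i,i_2,\dots,i_d}x_{i_2}\cdots x_{i_d}$, and $x^{\circ p}=(x_1^p,\dots,x_n^p)^\top$. An eigenvalue of $\mathcal T$ is $\lambda\in\mathbb C$ with $\mathcal T(x)=\lambda x^{\circ(d-1)}$ for some nonzero $x\in\mathbb C^n$; $\rho(\mathcal T)$ is the maximum modulus of the eigenvalues. $\mathcal F^{\circ\alpha}=[f_{i_1,\dots,i_d}^\alpha]$ is the entrywise power and $\circ$ between tensors is the entrywise (Hadamard) product. For vectors, $x>0$ means all entries are positive. $\mathcal T$ is weakly irreducible if the digraph on $[n]$ with an edge $(i,j)$ whenever $t_{i,j_1,\dots,j_{d-1}}>0$ for some $j_1,\dots,j_{d-1}$ with $j\in\{j_1,\dots,j_{d-1}\}$ is strongly connected (when $n=1$, the zero tensor is not regarded as weakly irreducible). A weakly irreducible $\mathcal T$ has a positive vector $u$, unique up to scaling, with $\mathcal T(u)=\rho(\mathcal T)u^{\circ(d-1)}$. If $\mathcal F^{\circ\alpha}\circ\mathcal G^{\circ\beta}$ is weakly irreducible, so are $\mathcal F$ and $\mathcal G$. *)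

(* Defs.v *)
(* The real numbers are an arbitrary [R : realType], the complex numbers [R[i]]. *)
From HB Require Import structures.
From mathcomp Require Import all_boot all_order all_algebra all_fingroup.
From mathcomp Require Import all_classical all_reals all_analysis.
From mathcomp Require Import complex.

Set Implicit Arguments.
Unset Strict Implicit.
Unset Printing Implicit Defensive.

Import Order.TTheory GRing.Theory Num.Theory.
Local Open Scope classical_set_scope.
Local Open Scope ring_scope.
Local Open Scope complex_scope.

(* The entry t_{i_1,i_2,...,i_d} is [T i_1 [tuple i_2; ...; i_d]]; the truncated
   predecessor [d.-1] is d - 1 as soon as 0 < d. *)
Definition tensor (K : Type) (d n : nat) := 'I_n -> d.-1.-tuple 'I_n -> K.

Definition tensor_map (K L : Type) (f : K -> L) (d n : nat)
  (T : tensor K d n) : tensor L d n := fun i j => f (T i j).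

Definition tensor_app (K : comNzRingType) (d n : nat) (T : tensor K d n)
  (x : 'cV[K]_n) : 'cV[K]_n :=
  \col_i \sum_(j : d.-1.-tuple 'I_n) T i j * \prod_(k < d.-1) x (tnth j k) 0.

Definition vec_pow (K : comNzRingType) (n : nat) (x : 'cV[K]_n) (p : nat) :
  'cV[K]_n := \col_i x i 0 ^+ p.

Definition pos_vec (R : realType) (n : nat) (x : 'cV[R]_n) : Prop :=
  forall i, 0 < x i 0.

Definition nonneg_tensor (R : realType) (d n : nat) (T : tensor R d n) : Prop :=
  forall i j, 0 <= T i j.

Definition partially_symmetric (K : Type) (d n : nat) (T : tensor K d n) : Prop :=
  forall i (j : d.-1.-tuple 'I_n) (s : 'S_(d.-1)),
    T i [tuple tnth j (s k) | k < d.-1] = T i j.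

Definition tensor_eigenvalue (R : realType) (d n : nat) (T : tensor R d n)
  (lambda : R[i]) : Prop :=
  exists2 x : 'cV[R[i]]_n, x != 0 &
    tensor_app (tensor_map (real_complex R) T) x = lambda *: vec_pow x d.-1.

Definition eigenvalue_moduli (R : realType) (d n : nat) (T : tensor R d n) :
  set R :=
  [set r | exists2 lambda, tensor_eigenvalue T lambda & `|lambda| = r%:C :> R[i]].

(* The greatest element of the set of moduli ([xget] would return the default
   value 0 if there were none). *)
Definition spectral_radius (R : realType) (d n : nat) (T : tensor R d n) : R :=
  xget 0 (eigenvalue_moduli T `&` ubound (eigenvalue_moduli T)).

(* For an exponent a > 0, [0 `^ a = 0]. *)
Definition hadamard_pow (R : realType) (d n : nat) (T : tensor R d n) (a : R) :
  tensor R d n := fun i j => T i j `^ a.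

Definition hadamard (R : realType) (d n : nat) (S T : tensor R d n) :
  tensor R d n := fun i j => S i j * T i j.

Definition tensor_edge (R : realType) (d n : nat) (T : tensor R d n) : rel 'I_n :=
  fun i k => [exists j : d.-1.-tuple 'I_n, (0 < T i j) && (k \in j)].

(* [connect] is reflexive, so for n = 1 the first conjunct always holds; the
   second one then excludes the zero tensor. *)
Definition weakly_irreducible (R : realType) (d n : nat) (T : tensor R d n) :
  Prop :=
  (forall i k, connect (tensor_edge T) i k) /\
  (n = 1%N -> exists i j, T i j != 0).

(* Main.v *)
(* Collatz-Wielandt: every eigenvalue modulus of a nonnegative tensor T is at
   most each c such that T(x) <= c x^(d-1) for some x > 0, and the infimum of
   these c is itself an eigenvalue with a nonnegative eigenvector, so it is
   rho(T). If F(x) <= c x^(d-1) and G(y) <= c' y^(d-1), Hoelder's inequality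
   applied to z = x^alpha y^beta gives H(z) <= c^alpha c'^beta z^(d-1) for the
   Hadamard mean H, which proves the inequality. In the case of equality, weak
   irreducibility forces w = u^alpha v^beta to be an eigenvector of H: the set
   of indices where a nonnegative eigenvector x of H attains the maximum of
   x_i / w_i is closed under the edges of the digraph. Then all Hoelder
   inequalities are equalities, that is, the families f u...u and g v...v are
   proportional for every i_1. *)
Require Import Defs.
From HB Require Import structures.
From mathcomp Require Import all_boot all_order all_algebra all_fingroup.
From mathcomp Require Import all_classical all_reals all_analysis.
From mathcomp Require Import complex.

Set Implicit Arguments.
Unset Strict Implicit.
Unset Printing Implicit Defensive.

Import Order.TTheory GRing.Theory Num.Theory.
Import numFieldNormedType.Exports.
Local Open Scope ring_scope.

(** * Continuity of finite sums and products *)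

Lemma continuous_sumr (R : realType) (T : topologicalType) (I : Type)
  (r : seq I) (F : I -> T -> R) : (forall i, continuous (F i)) ->
  continuous (fun x => \sum_(i <- r) F i x).
Proof. by move=> cF; exact: (continuous_big (@add_continuous R^o) (fun i _ => cF i)). Qed.

Lemma continuous_prodr (R : realType) (T : topologicalType) (I : Type)
  (r : seq I) (F : I -> T -> R) : (forall i, continuous (F i)) ->
  continuous (fun x => \prod_(i <- r) F i x).
Proof. by move=> cF; exact: (continuous_big (@mul_continuous R) (fun i _ => cF i)). Qed.

(** * Monotonicity of tensor application and Collatz-Wielandt bounds *)

Section TensorApp.
Local Open Scope classical_set_scope.
Variables (R : realType) (d n : nat).
Implicit Types (T : tensor R d n) (x y w : 'cV[R]_n).

Lemma tensor_app_ge0 T x i : nonneg_tensor T -> (forall k, 0 <= x k 0) ->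
  0 <= tensor_app T x i 0.
Proof.
move=> T_ge0 x_ge0; rewrite mxE sumr_ge0// => j _.
by rewrite mulr_ge0 ?T_ge0 ?prodr_ge0.
Qed.

Lemma ler_tensor_app T x y i : nonneg_tensor T ->
  (forall k, 0 <= x k 0 <= y k 0) -> tensor_app T x i 0 <= tensor_app T y i 0.
Proof.
move=> T_ge0 xy; rewrite !mxE ler_sum// => j _.
by rewrite ler_wpM2l ?T_ge0 ?ler_prod.
Qed.

Lemma tensor_appZ T t x i :
  tensor_app T (t *: x) i 0 = t ^+ d.-1 * tensor_app T x i 0.
Proof.
rewrite !mxE mulr_sumr; apply: eq_bigr => j _.
under eq_bigr do rewrite mxE.
by rewrite big_split/= prodr_const card_ord mulrCA.
Qed.

(** The scalar [t] is the maximum of [x k 0 / w k 0]: the multiple [t *: w] dominates [x] and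
    touches it at [i]. *)
Lemma exists_max_ratio x w : pos_vec w -> (forall k, 0 <= x k 0) -> x != 0 ->
  exists t i, [/\ 0 < t, x i 0 = t * w i 0 & forall k, x k 0 <= t * w k 0].
Proof.
move=> w_gt0 x_ge0 /eqP x_neq0.
have [i0 x_i0] : exists i0, x i0 0 != 0.
  apply: contrapT => nx; apply: x_neq0; apply/matrixP => i k.
  rewrite ord1 mxE; apply/eqP; apply: contrapT => /negP xi.
  by apply: nx; exists i.
have [i _ imax] := arg_maxP (fun k => x k 0 / w k 0) (erefl : predT i0).
have t_gt0 : 0 < x i 0 / w i 0.
  apply: lt_le_trans (imax i0 erefl); rewrite divr_gt0// ?w_gt0//.
  by rewrite lt_def x_i0 x_ge0.
exists (x i 0 / w i 0), i; split=> // [|k].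
  by rewrite divfK// gt_eqF.
by rewrite -ler_pdivrMr ?w_gt0//; exact: imax.
Qed.

(* The upper Collatz-Wielandt numbers of T; their infimum is the spectral
   radius. *)
Definition superharmonic_values T : set R :=
  [set c | exists2 x, pos_vec x &
    forall i, tensor_app T x i 0 <= c * x i 0 ^+ d.-1].

(** Scale the superharmonic vector until it touches [y] from above, at [i]. There monotonicity gives
    s y_i^(d-1) <= T(y)_i <= T(t x)_i <= c y_i^(d-1), and y_i > 0. *)
Lemma superharmonic_value_ge T c y s : nonneg_tensor T ->
  superharmonic_values T c -> (forall k, 0 <= y k 0) -> y != 0 ->
  (forall i, s * y i 0 ^+ d.-1 <= tensor_app T y i 0) -> s <= c.
Proof.
move=> T_ge0 [x x_gt0 Tx] y_ge0 y_neq0 Ty.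
have [t [i [t_gt0 yi ymax]]] := exists_max_ratio x_gt0 y_ge0 y_neq0.
have : s * y i 0 ^+ d.-1 <= c * y i 0 ^+ d.-1.
  apply: (le_trans (Ty i)).
  apply: (@le_trans _ _ (tensor_app T (t *: x) i 0)).
    by apply: ler_tensor_app => // k; rewrite mxE y_ge0 ymax.
  rewrite tensor_appZ yi exprMn mulrCA ler_pM2l ?exprn_gt0//.
by rewrite ler_pM2r ?exprn_gt0// yi mulr_gt0.
Qed.

(** * Continuity and a compact set of normalised vectors *)

Lemma continuous_tensor_app T i :
  continuous (fun x : 'rV[R]_n => tensor_app T x^T i 0).
Proof.
rewrite [X in continuous X](_ : _ = fun x : 'rV[R]_n =>
    \sum_(j : d.-1.-tuple 'I_n) T i j * \prod_(k < d.-1) x 0 (tnth j k)).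
  apply: continuous_sumr => j x.
  have cP : continuous (fun x : 'rV[R]_n => \prod_(k < d.-1) x 0 (tnth j k)).
    by apply: continuous_prodr => k; exact: coord_continuous.
  exact: (cvgM (cvg_cst (T i j)) (cP x)).
apply/funext => x; rewrite mxE; apply: eq_bigr => j _; congr (_ * _).
by apply: eq_bigr => k _; rewrite mxE.
Qed.

(* The vectors of sup norm 1 in [0, 1]^n, the product being 0 iff some coordinate
   is 1. *)
Definition cube_outer_faces : set 'rV[R]_n :=
  [set x | forall k, `[0, 1] (x ord0 k)] `&` [set x | \prod_k (1 - x 0 k) = 0].

Lemma compact_cube_outer_faces : compact cube_outer_faces.
Proof.
apply: compact_closedI.
  by apply: (@rV_compact R n (fun=> `[0, 1])) => k; exact: segment_compact.
apply: (@preimage_closed _ _ (fun x : 'rV[R]_n => \prod_k (1 - x 0 k)) [set 0]).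
  move=> x _; move: x; apply: continuous_prodr => k x.
  by apply: continuousB; [exact: cst_continuous|exact: coord_continuous].
exact: closed_eq.
Qed.

Lemma cube_outer_faces_const1 : (0 < n)%N -> cube_outer_faces (const_mx 1).
Proof.
move=> n_gt0; split => /= [k|]; first by rewrite /= in_itv/= mxE lexx ler01.
apply/eqP; rewrite prodf_seq_eq0; apply/hasP; exists (Ordinal n_gt0).
  exact: mem_index_enum.
by rewrite mxE subrr eqxx.
Qed.

Lemma cube_outer_faces_coord1 x : cube_outer_faces x^T -> exists i, x i 0 = 1.
Proof.
move=> [_ /= /eqP]; rewrite prodf_seq_eq0 => /hasP[i _].
by rewrite subr_eq0 mxE => /eqP xi; exists i.
Qed.

Lemma cube_outer_faces_coord x k : cube_outer_faces x^T -> 0 <= x k 0 <= 1.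
Proof. by move=> [/(_ k)]; rewrite /= in_itv/= mxE. Qed.

Lemma cube_outer_faces_neq0 x : cube_outer_faces x^T -> x != 0.
Proof.
move=> /cube_outer_faces_coord1[i xi]; apply: contra_eq_neq xi => ->.
by rewrite mxE eq_sym oner_neq0.
Qed.

(** Divide by the largest entry, found as the maximal ratio of [x] to the all-ones vector. *)
Lemma cube_outer_facesZ x : (forall k, 0 <= x k 0) -> x != 0 ->
  exists2 t, 0 < t & cube_outer_faces (t^-1 *: x)^T.
Proof.
move=> x_ge0 x_neq0.
have one_gt0 : pos_vec (const_mx 1 : 'cV[R]_n) by move=> i; rewrite mxE.
have [t [i [t_gt0]]] := exists_max_ratio one_gt0 x_ge0 x_neq0.
rewrite mxE mulr1 => xi xk; exists t => //; split => /=.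
  move=> k; rewrite in_itv/= !mxE mulr_ge0//= ?invr_ge0 ?(ltW t_gt0)//.
  by rewrite [_^-1 * _]mulrC ler_pdivrMr// mul1r (le_trans (xk k))// mxE mulr1.
apply/eqP; rewrite prodf_seq_eq0; apply/hasP; exists i; first exact: mem_index_enum.
by rewrite !mxE xi (mulVf (lt0r_neq0 t_gt0)) subrr eqxx.
Qed.

(** * Eigenvectors of entrywise positive tensors *)

(** A strict increase in the single term [j] suffices. One occurrence of [k] in [j] is singled out;
    the remaining factors of [x] may vanish, so they are first replaced by those of [y], which are
    positive along [j]. *)
Lemma ltr_tensor_app T x y i (j : d.-1.-tuple 'I_n) k : nonneg_tensor T ->
  (forall l, 0 <= x l 0 <= y l 0) -> 0 < T i j -> {in j, forall l, 0 < y l 0} ->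
  k \in j -> x k 0 < y k 0 -> tensor_app T x i 0 < tensor_app T y i 0.
Proof.
move=> T_ge0 xy Tij y_gt0 /tnthP[l ->] xyl; rewrite !mxE.
rewrite (bigD1 j)//= [ltRHS](bigD1 j)//=; apply: ltr_leD; last first.
  by apply: ler_sum => j' _; rewrite ler_wpM2l ?T_ge0// ler_prod.
rewrite ltr_pM2l// (bigD1 l)//= [ltRHS](bigD1 l)//=.
apply: (@le_lt_trans _ _ (x (tnth j l) 0 * \prod_(m < d.-1 | m != l) y (tnth j m) 0)).
  by rewrite ler_wpM2l// ?ler_prod//; case/andP: (xy (tnth j l)).
by rewrite ltr_pM2r// prodr_gt0// => m _; rewrite y_gt0// mem_tnth.
Qed.

Lemma ltr_tensor_app_pos T x y i k : (0 < d.-1)%N -> (forall i j, 0 < T i j) ->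
  (forall l, 0 <= x l 0 <= y l 0) -> x k 0 < y k 0 ->
  tensor_app T x i 0 < tensor_app T y i 0.
Proof.
move=> d_gt0 T_gt0 xy xyk.
(* Along the constant tuple the only coordinate involved is y_k, positive because it exceeds x_k >=
   0. *)
apply: (@ltr_tensor_app T x y i [tuple of nseq d.-1 k] k) => //.
- by move=> i' j; exact: ltW.
- by move=> l /nseqP[-> _]; case/andP: (xy k) => xk_ge0 _; exact: le_lt_trans xyk.
- by rewrite mem_nseq d_gt0 eqxx.
Qed.

Lemma tensor_app_le_sum T x i : nonneg_tensor T -> cube_outer_faces x^T ->
  tensor_app T x i 0 <= \sum_k \sum_(j : d.-1.-tuple 'I_n) T k j.
Proof.
move=> T_ge0 Kx; rewrite (bigD1 i)//= mxE -[leLHS]addr0 lerD//; last first.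
  by rewrite sumr_ge0// => k _; rewrite sumr_ge0// => j _; exact: T_ge0.
apply: ler_sum => j _; rewrite ler_piMr ?T_ge0// prodr_ile1// => k _.
exact: cube_outer_faces_coord.
Qed.

(** A priori bound, read off at a coordinate equal to 1; it confines the values s to a segment in
    the compactness arguments. *)
Lemma subeigenvalue_le_sum T x s : nonneg_tensor T -> cube_outer_faces x^T ->
  (forall i, s * x i 0 ^+ d.-1 <= tensor_app T x i 0) ->
  s <= \sum_k \sum_(j : d.-1.-tuple 'I_n) T k j.
Proof.
move=> T_ge0 Kx Tx; have [i xi] := cube_outer_faces_coord1 Kx.
have := Tx i; rewrite xi expr1n mulr1 => /le_trans; apply.
exact: tensor_app_le_sum.
Qed.

Definition eigen_residual T i (p : 'rV[R]_n * R) : R :=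
  tensor_app T p.1^T i 0 - p.2 * p.1 0 i ^+ d.-1.

Lemma continuous_eigen_residual T i : continuous (eigen_residual T i).
Proof.
have c1 : continuous (fst : 'rV[R]_n * R -> _) by move=> p; exact: cvg_fst.
have cT : continuous (fun p : 'rV[R]_n * R => tensor_app T p.1^T i 0).
  by move=> p; exact: (continuous_comp (c1 p) (@continuous_tensor_app T i p.1)).
have cx : continuous (fun p : 'rV[R]_n * R => p.1 0 i).
  by move=> p; exact: (continuous_comp (c1 p) (@coord_continuous R 1 n 0 i p.1)).
have cX : continuous (fun p : 'rV[R]_n * R => p.1 0 i ^+ d.-1).
  by move=> p; exact: (continuous_comp (cx p) (@exprn_continuous R d.-1 _)).
by move=> p; exact: (cvgB (cT p) (cvgM cvg_snd (cX p))).
Qed.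

Lemma compact_faces_segment (a b : R) : compact (cube_outer_faces `*` `[a, b]).
Proof.
by apply: compact_setX; [exact: compact_cube_outer_faces|exact: segment_compact].
Qed.

(** Raise coordinate [i0], where there is slack, slightly. The inequality at [i0] stays strict by
    continuity, all others become strict because T is entrywise positive, and finitely many strict
    inequalities leave room to increase s. *)
Lemma subeigenvector_improve T x s i0 : (0 < d.-1)%N -> (forall i j, 0 < T i j) ->
  (forall k, 0 <= x k 0) ->
  (forall i, s * x i 0 ^+ d.-1 <= tensor_app T x i 0) ->
  s * x i0 0 ^+ d.-1 < tensor_app T x i0 0 -> 0 <= s ->
  exists y s', [/\ forall k, 0 <= y k 0, y != 0, s < s' &
    forall i, s' * y i 0 ^+ d.-1 <= tensor_app T y i 0].
Proof.
move=> d_gt0 T_gt0 x_ge0 Tx Tx0 s_ge0.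
have T_ge0 : nonneg_tensor T by move=> i j; exact: ltW.
have [e e_gt0 Te] : exists2 e, 0 < e &
    s * (x i0 0 + e) ^+ d.-1 < tensor_app T x i0 0.
  have cs : s * (x i0 0 + e) ^+ d.-1 @[e --> (0:R)^'+] --> s * x i0 0 ^+ d.-1.
    rewrite -[in X in _ --> X](addr0 (x i0 0)).
    apply: cvg_at_right_filter.
    apply: (cvgM (cvg_cst s)).
    have cD : (x i0 0 + e) @[e --> (0:R)] --> x i0 0 + 0.
      by apply: (cvgD (cvg_cst _)); exact: cvg_id.
    exact: (cvg_comp _ _ cD (@exprn_continuous R d.-1 _)).
  have /filter_ex : \forall e \near (0:R)^'+,
      0 < e /\ s * (x i0 0 + e) ^+ d.-1 < tensor_app T x i0 0.
    near=> e; split; first by near: e; exact: nbhs_right_gt.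
    by near: e; exact: (cvgr_lt _ cs).
  by case=> e [e_gt0 Te]; exists e.
pose y := x + e *: delta_mx i0 0.
have yE i : y i 0 = x i 0 + e * (i == i0)%:R by rewrite !mxE andbT.
have xy k : 0 <= x k 0 <= y k 0.
  by rewrite x_ge0 yE lerDl mulr_ge0// ltW.
have xy0 : x i0 0 < y i0 0 by rewrite yE eqxx mulr1 ltrDl.
have Ty i : s * y i 0 ^+ d.-1 < tensor_app T y i 0.
  have [->|ii0] := eqVneq i i0.
    rewrite {1}yE eqxx mulr1; apply: lt_le_trans Te _.
    exact: ler_tensor_app.
  rewrite {1}yE (negPf ii0) mulr0 addr0; apply: le_lt_trans (Tx i) _.
  exact: ltr_tensor_app_pos xy0.
have [s' ss' Ts'] : exists2 s', s < s' &
    forall i, s' * y i 0 ^+ d.-1 < tensor_app T y i 0.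
  have cs i : t * y i 0 ^+ d.-1 @[t --> s^'+] --> s * y i 0 ^+ d.-1.
    apply: cvg_at_right_filter.
    by apply: cvgM; [exact: cvg_id|exact: cvg_cst].
  have /filter_ex : \forall t \near s^'+,
      s < t /\ forall i, t * y i 0 ^+ d.-1 < tensor_app T y i 0.
    near=> t; split; first by near: t; exact: nbhs_right_gt.
    near: t; apply: filter_forall => i.
    exact: (cvgr_lt _ (cs i)).
  by case=> t [st Tt]; exists t.
exists y, s'; split=> // [k||i]; last exact: ltW.
  by case/andP: (xy k); exact: le_trans.
apply: contraTneq xy0 => ->; rewrite mxE -leNgt; exact: x_ge0.
Unshelve. all: by end_near. Qed.

(** Maximise s over normalised x >= 0 with s x^(d-1) <= T(x). Slack at any index would allow a
    larger s, so a maximiser satisfies the eigenvalue equation. *)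
Lemma positive_tensor_eigenvector T : (0 < n)%N -> (0 < d.-1)%N ->
  (forall i j, 0 < T i j) ->
  exists x s, [/\ cube_outer_faces x^T, pos_vec x &
    forall i, tensor_app T x i 0 = s * x i 0 ^+ d.-1].
Proof.
move=> n_gt0 d_gt0 T_gt0.
have T_ge0 : nonneg_tensor T by move=> i j; exact: ltW.
set M := \sum_k \sum_(j : d.-1.-tuple 'I_n) T k j.
pose C := cube_outer_faces `*` `[0, M] `&`
  \bigcap_(i in [set: 'I_n]) (eigen_residual T i @^-1` [set r | 0 <= r]).
have C0 : C !=set0.
  exists (const_mx 1, 0); split => /=; last first.
    move=> i _ /=; rewrite /eigen_residual /= mul0r subr0.
    by apply: tensor_app_ge0 => // k; rewrite !mxE.
  split => /=; last first.
    rewrite in_itv/= lexx; apply: sumr_ge0 => k _; apply: sumr_ge0 => j _.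
    exact: T_ge0.
  exact: cube_outer_faces_const1.
have cC : compact C.
  apply: compact_closedI; first exact: compact_faces_segment.
  apply: closed_bigI => i _; apply: preimage_closed; last exact: closed_ge.
  by move=> p _; exact: continuous_eigen_residual.
have [[z s]] : exists2 p, p \in C & forall q, q \in C -> q.2 <= p.2.
  apply: (compact_EVT_max C0 cC); apply: continuous_subspaceT => p.
  exact: cvg_snd.
rewrite inE => -[[/= Kz]]; rewrite in_itv/= => /andP[s_ge0 sM] Cz zmax.
pose x := z^T; have Kx : cube_outer_faces x^T by rewrite trmxK.
have Tx i : s * x i 0 ^+ d.-1 <= tensor_app T x i 0.
  rewrite [x i 0]mxE -subr_ge0; exact: Cz.
have x_ge0 k : 0 <= x k 0 by have /andP[] := cube_outer_faces_coord k Kx.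
have Txe i : tensor_app T x i 0 = s * x i 0 ^+ d.-1.
  apply/eqP; rewrite eq_le Tx andbT leNgt; apply/negP => Txi.
  have [y [s' [y_ge0 y_neq0 ss' Ty]]] :=
    subeigenvector_improve d_gt0 T_gt0 x_ge0 Tx Txi s_ge0.
  have [t t_gt0 Kw] := cube_outer_facesZ y_ge0 y_neq0.
  pose w := t^-1 *: y.
  have Tw k : s' * w k 0 ^+ d.-1 <= tensor_app T w k 0.
    by rewrite tensor_appZ mxE exprMn mulrCA ler_pM2l ?exprn_gt0 ?invr_gt0.
  have : (w^T, s') \in C.
    rewrite inE; split => /= [|k _ /=]; last first.
      by rewrite /eigen_residual /= trmxK subr_ge0 [w^T _ _]mxE.
    split => //=; rewrite in_itv/= (le_trans s_ge0 (ltW ss'))/=.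
    exact: subeigenvalue_le_sum Tw.
  by move=> /zmax /=; rewrite leNgt ss'.
exists x, s; split => // i.
(* A zero coordinate would give T(x)_i = 0 since d - 1 > 0, whereas T > 0 and an entry of x equal to
   1 force T(x)_i > T(0)_i >= 0. *)
rewrite lt_def x_ge0 andbT; apply/eqP => xi0.
have [k xk] := cube_outer_faces_coord1 Kx.
have : tensor_app T 0 i 0 < tensor_app T x i 0.
  apply: (@ltr_tensor_app_pos T 0 x i k) => // [l|].
    by rewrite mxE lexx x_ge0.
  by rewrite mxE xk.
rewrite Txe xi0 expr0n eqn0Ngt d_gt0 mulr0 ltNge tensor_app_ge0// => l.
by rewrite mxE.
Qed.

(** * The Collatz-Wielandt infimum is the spectral radius *)

Definition superharmonic_inf T : R := inf (superharmonic_values T).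

(** The all-ones vector serves twice: as [y] with s = 0 for the lower bound 0, and as a
    superharmonic vector, with the sum of all entries, for nonemptiness. *)
Lemma has_inf_superharmonic_values T : (0 < n)%N -> nonneg_tensor T ->
  has_inf (superharmonic_values T) /\ lbound (superharmonic_values T) 0.
Proof.
move=> n_gt0 T_ge0; have lb0 : lbound (superharmonic_values T) 0.
  move=> c Uc; apply: (superharmonic_value_ge (y := const_mx 1) T_ge0 Uc).
  - by move=> k; rewrite mxE.
  - apply/eqP => /matrixP/(_ (Ordinal n_gt0) 0); rewrite !mxE.
    by apply/eqP; exact: oner_neq0.
  - by move=> i; rewrite mul0r tensor_app_ge0// => k; rewrite mxE.
split=> //; split; last by exists 0.
exists (\sum_k \sum_(j : d.-1.-tuple 'I_n) T k j); exists (const_mx 1).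
  by move=> k; rewrite mxE.
move=> i; rewrite [const_mx _ _ _]mxE expr1n mulr1; apply: tensor_app_le_sum => //.
by rewrite trmx_const; exact: cube_outer_faces_const1.
Qed.

Lemma superharmonic_inf_ge0 T : (0 < n)%N -> nonneg_tensor T ->
  0 <= superharmonic_inf T.
Proof.
move=> n_gt0 T_ge0.
have [[U0 _] lb0] := has_inf_superharmonic_values n_gt0 T_ge0.
exact: lb_le_inf.
Qed.

Lemma superharmonic_inf_le T c : (0 < n)%N -> nonneg_tensor T ->
  superharmonic_values T c -> superharmonic_inf T <= c.
Proof.
move=> n_gt0 T_ge0; apply: ge_inf.
by have [[_ +] _] := has_inf_superharmonic_values n_gt0 T_ge0.
Qed.

(* Perturbing T by a small constant e > 0 gives an eigenpair whose residual for
   T is O(e), so the minimum of the total residual is 0. *)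
Lemma superharmonic_inf_eigenvector T : (0 < n)%N -> (0 < d.-1)%N ->
  nonneg_tensor T ->
  exists2 x : 'cV[R]_n, (forall k, 0 <= x k 0) /\ x != 0 &
    forall i, tensor_app T x i 0 = superharmonic_inf T * x i 0 ^+ d.-1.
Proof.
move=> n_gt0 d_gt0 T_ge0.
set r := superharmonic_inf T.
pose Te (e : R) : tensor R d n := fun i j => T i j + e.
(* [N] is the number of entries of T; on the unit cube the perturbation e adds at most e N to the
   total residual. *)
pose N : R := \sum_(k < n) \sum_(j : d.-1.-tuple 'I_n) 1.
(* The a priori bound at e = 1 serves all e <= 1, so [A] does not depend on e. *)
pose M := \sum_k \sum_(j : d.-1.-tuple 'I_n) Te 1 k j.
pose A := cube_outer_faces `*` `[r, M].
pose phi p := \sum_i `|eigen_residual T i p|.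
have appTe e x i : tensor_app (Te e) x i 0 = tensor_app T x i 0 +
    e * \sum_(j : d.-1.-tuple 'I_n) \prod_(k < d.-1) x (tnth j k) 0.
  rewrite !mxE mulr_sumr -big_split/=; apply: eq_bigr => j _.
  by rewrite mulrDl.
have approx e : 0 < e -> e <= 1 -> exists2 p, A p & phi p <= e * N.
  move=> e_gt0 e_le1.
  have Te_gt0 i j : 0 < Te e i j by rewrite /Te ltr_wpDl.
  have [x [s [Kx x_gt0 Txs]]] := positive_tensor_eigenvector n_gt0 d_gt0 Te_gt0.
  have x01 k : 0 <= x k 0 <= 1 by exact: cube_outer_faces_coord.
  have sumx_ge0 : 0 <= \sum_(j : d.-1.-tuple 'I_n) \prod_(k < d.-1) x (tnth j k) 0.
    by apply: sumr_ge0 => j _; apply: prodr_ge0 => k _; case/andP: (x01 (tnth j k)).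
  exists (x^T, s).
    split => //=; rewrite in_itv/=; apply/andP; split.
      (* Since T <= T + e, the eigenvector of T + e is superharmonic for T with value s. *)
      apply: superharmonic_inf_le => //; exists x => // i.
      by rewrite -Txs appTe lerDl mulr_ge0// ltW.
    apply: (@le_trans _ _ (\sum_k \sum_(j : d.-1.-tuple 'I_n) Te e k j)).
      apply: subeigenvalue_le_sum Kx _ => [i j|i]; first exact: ltW.
      by rewrite Txs.
    by apply: ler_sum => k _; apply: ler_sum => j _; rewrite lerD2l.
  rewrite mulr_sumr; apply: ler_sum => i _.
  rewrite /eigen_residual /= trmxK [x^T _ _]mxE -Txs appTe opprD addNKr normrN.
  rewrite ger0_norm ?mulr_ge0 ?(ltW e_gt0)// ler_wpM2l ?(ltW e_gt0)//.
  by apply: ler_sum => j _; apply: prodr_ile1 => k _; exact: x01.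
have A0 : A !=set0 by have [//|//|p Ap _] := approx 1; exists p.
have [p] : exists2 p, p \in A & forall q, q \in A -> phi p <= phi q.
  apply: (compact_EVT_min A0 (@compact_faces_segment r M)).
  apply: continuous_subspaceT; apply: continuous_sumr => i q.
  apply: (continuous_comp (@continuous_eigen_residual T i q)).
  exact: norm_continuous.
rewrite inE => -[/= Kp]; rewrite in_itv/= => /andP[rp pM] pmin.
have phi_le0 : phi p <= 0.
  have N_ge0 : 0 <= N by apply: sumr_ge0 => k _; exact: sumr_ge0.
  rewrite leNgt; apply/negP => phi_gt0.
  (* This choice gives e N < e (N + 1) <= phi p, against minimality. *)
  pose e := Num.min 1 (phi p / (N + 1)).
  have N1_gt0 : 0 < N + 1 by rewrite ltr_wpDl.
  have e_gt0 : 0 < e by rewrite lt_min ltr01 divr_gt0.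
  have e_le1 : e <= 1 by rewrite ge_min lexx.
  have [q Aq] := approx e e_gt0 e_le1.
  apply/negP; rewrite -ltNge; apply: (@lt_le_trans _ _ (phi p)).
    apply: (@lt_le_trans _ _ (e * (N + 1))).
      by rewrite mulrDr mulr1 ltrDl.
    by rewrite -ler_pdivlMr// ge_min lexx orbT.
  by apply: pmin; rewrite inE.
have res0 i : eigen_residual T i p = 0.
  apply/eqP; rewrite -normr_eq0.
  have : phi p == 0 by rewrite eq_le phi_le0 sumr_ge0.
  by rewrite psumr_eq0// => /allP/(_ i (mem_index_enum _)).
pose x := p.1^T; have Kx : cube_outer_faces x^T by rewrite trmxK.
have Txp i : tensor_app T x i 0 = p.2 * x i 0 ^+ d.-1.
  by apply/eqP; rewrite [x i 0]mxE -subr_eq0; apply/eqP; exact: res0.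
have x_ge0 k : 0 <= x k 0 by have /andP[] := cube_outer_faces_coord k Kx.
have x_neq0 := cube_outer_faces_neq0 Kx.
(* The constraint in [A] gives r <= p.2; conversely, an eigenvalue with a nonnegative eigenvector is
   at most every superharmonic value. *)
have pr : p.2 = r.
  apply/eqP; rewrite eq_le rp andbT.
  have [[U0 _] _] := has_inf_superharmonic_values n_gt0 T_ge0.
  apply: lb_le_inf => // c Uc.
  by apply: superharmonic_value_ge Uc x_ge0 x_neq0 _ => // i; rewrite Txp.
by exists x => // i; rewrite Txp pr.
Qed.

(** By the triangle inequality the moduli y_i = |x_i| satisfy r y^(d-1) <= T(y), which is compared
    with the superharmonic vector. *)
Lemma eigenvalue_modulus_le T c r : nonneg_tensor T ->
  superharmonic_values T c -> eigenvalue_moduli T r -> r <= c.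
Proof.
move=> T_ge0 Uc [lambda [x x_neq0 Tx] lambda_r].
(* The norm on [R[i]] takes values in [R[i]], hence the real part. *)
pose y : 'cV[R]_n := \col_i complex.Re `|x i 0|.
have yE i : (y i 0)%:C%C = `|x i 0| by rewrite mxE RRe_real// normr_real.
apply: (superharmonic_value_ge (y := y) T_ge0 Uc).
- by move=> k; rewrite -lecR yE rmorph0 normr_ge0.
- apply: contra_neq x_neq0 => y0; apply/matrixP => i k; rewrite ord1 mxE.
  by apply/eqP; rewrite -normr_eq0 -yE y0 mxE.
- move=> i; rewrite -lecR rmorphM rmorphXn/= yE -lambda_r -normrX -normrM.
  have /matrixP/(_ i 0) := Tx; rewrite !mxE => <-.
  apply: le_trans (ler_norm_sum _ _ _) _.
  rewrite rmorph_sum/= ler_sum// => j _.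
  rewrite normrM normr_prod rmorphM rmorph_prod/=.
  under [in leRHS]eq_bigr do rewrite yE.
  by rewrite /tensor_map normc_def/= expr0n/= addr0 sqrtr_sqr ger0_norm ?T_ge0.
Qed.

(** The infimum bounds all moduli and is attained as one, so [xget] returns it and not its
    default. *)
Lemma spectral_radiusE T : (0 < n)%N -> (0 < d.-1)%N -> nonneg_tensor T ->
  spectral_radius T = superharmonic_inf T.
Proof.
move=> n_gt0 d_gt0 T_ge0.
have ub : ubound (eigenvalue_moduli T) (superharmonic_inf T).
  move=> r Tr; have [[U0 _] _] := has_inf_superharmonic_values n_gt0 T_ge0.
  by apply: lb_le_inf => // c Uc; exact: eigenvalue_modulus_le Tr.
have mem : eigenvalue_moduli T (superharmonic_inf T).
  have [x [x_ge0 x_neq0] Tx] := superharmonic_inf_eigenvector n_gt0 d_gt0 T_ge0.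
  exists (superharmonic_inf T)%:C%C; last first.
    by rewrite normc_def/= expr0n/= addr0 sqrtr_sqr ger0_norm ?superharmonic_inf_ge0.
  exists (map_mx (real_complex R) x).
    by rewrite map_mx_eq0.
  apply/matrixP => i k; rewrite ord1 !mxE -rmorphXn -rmorphM -Tx mxE rmorph_sum/=.
  apply: eq_bigr => j _; rewrite rmorphM rmorph_prod/=; congr (_ * _).
  by apply: eq_bigr => l _; rewrite mxE.
apply: xget_unique => // r [Tr ubr].
by apply/eqP; rewrite eq_le ub//= ubr.
Qed.


(** * Consequences of weak irreducibility *)

(** Strong maximum principle. Let t w touch x from above. If x_i = t w_i and x_k < t w_k for an edge
    (i, k), then T(x)_i < T(t w)_i <= c (t w_i)^(d-1) = T(x)_i, a contradiction. So contact spreads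
    along edges and x = t w. *)
Lemma superharmonic_rigidity T c w x : (0 < n)%N -> nonneg_tensor T ->
  (forall i k, connect (tensor_edge T) i k) ->
  pos_vec w -> (forall i, tensor_app T w i 0 <= c * w i 0 ^+ d.-1) ->
  (forall k, 0 <= x k 0) -> x != 0 ->
  (forall i, tensor_app T x i 0 = c * x i 0 ^+ d.-1) ->
  forall i, tensor_app T w i 0 = c * w i 0 ^+ d.-1.
Proof.
move=> n_gt0 T_ge0 Tconn w_gt0 Tw x_ge0 x_neq0 Tx.
have [t [i0 [t_gt0 xi0 xw]]] := exists_max_ratio w_gt0 x_ge0 x_neq0.
have tw k : 0 <= x k 0 <= (t *: w) k 0 by rewrite x_ge0 mxE xw.
have tm_gt0 : 0 < t ^+ d.-1 by exact: exprn_gt0.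
have Ttw i : tensor_app T (t *: w) i 0 <= c * (t *: w) i 0 ^+ d.-1.
  by rewrite tensor_appZ [(t *: w) i 0]mxE exprMn mulrCA ler_pM2l.
pose S := [pred i | x i 0 == (t *: w) i 0].
have closedS i k : tensor_edge T i k -> S i -> S k.
  move=> /existsP[j /andP[Tij kj]] /eqP Si.
  apply: contraT => Sk.
  have : tensor_app T x i 0 < tensor_app T (t *: w) i 0.
    apply: (ltr_tensor_app (j := j) (k := k)) => //.
      by move=> l _; rewrite mxE mulr_gt0.
    by rewrite lt_neqAle Sk; case/andP: (tw k).
  by rewrite Tx Si ltNge Ttw.
have allS k : S k.
  have /connectP[p] := Tconn i0 k.
  have : S i0 by rewrite /S /= xi0 mxE.
  elim: p i0 {xi0} => [|l p IHp] i Si /= => [_ -> //|/andP[il pl]].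
  exact: IHp (closedS _ _ il Si) pl.
move=> i; apply/eqP; rewrite eq_le Tw -(ler_pM2l tm_gt0) -tensor_appZ mulrCA.
by have /eqP := allS i; rewrite mxE -exprMn => <-; rewrite -Tx ler_tensor_app.
Qed.

(** For n > 1 a path from i to another index starts with an edge, hence a positive entry; n = 1 is
    the second conjunct of [weakly_irreducible]. *)
Lemma weakly_irreducible_row_neq0 T i : nonneg_tensor T -> weakly_irreducible T ->
  exists j, 0 < T i j.
Proof.
move=> T_ge0 [Tconn T1].
have [n1|/eqP n1] := eqVneq n 1%N.
  have [i' [j Tij]] := T1 n1; exists j.
  have ord_eq0 (k : 'I_n) : k = 0%N :> nat.
    by apply/eqP; rewrite -leqn0 -ltnS -[X in (_ < X)%N]n1.
  have -> : i = i' by apply: ord_inj; rewrite !ord_eq0.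
  by rewrite lt_def Tij T_ge0.
have [k ki] : exists k, k != i.
  apply: contrapT => nk; apply: n1; rewrite -(card_ord n).
  apply/eqP/(fintype1P); exists i => k.
  by apply/eqP; apply: contrapT => /negP ki; apply: nk; exists k.
have /connectP[[|l p] /=] := Tconn i k; first by move=> _ ki'; rewrite ki' eqxx in ki.
by case/andP => /existsP[j /andP[Tij _]] _ _; exists j.
Qed.

End TensorApp.

(** * Weighted arithmetic-geometric mean and Hoelder inequalities *)

Section WeightedMeans.
Variables (R : realType) (alpha beta : R).
Hypotheses (alpha_gt0 : 0 < alpha) (beta_gt0 : 0 < beta).
Hypothesis alpha_beta : alpha + beta = 1.

Lemma powR_prod (a : R) (I : Type) (r : seq I) (f : I -> R) :
  (forall i, 0 <= f i) ->
  (\prod_(i <- r) f i) `^ a = \prod_(i <- r) f i `^ a.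
Proof.
move=> f_ge0; elim: r => [|i r IHr]; first by rewrite !big_nil powR1.
by rewrite !big_cons powRM ?prodr_ge0// IHr.
Qed.

(* This avoids the continuity of powR at 0. *)
Lemma ler_powR_limit (h k a p : R) : 0 <= k -> 0 <= a -> 0 < p ->
  (forall c, a < c -> h <= k * c `^ p) -> h <= k * a `^ p.
Proof.
move=> k_ge0 a_ge0 p_gt0 hc.
have [h_le0|h_gt0] := leP h 0; first by rewrite (le_trans h_le0)// mulr_ge0// powR_ge0.
have [k0|k_neq0] := eqVneq k 0.
  by have := hc (a + 1); rewrite k0 !mul0r; apply; rewrite ltrDl.
have k_gt0 : 0 < k by rewrite lt_def k_neq0.
have hk_ge0 : 0 <= h / k by rewrite divr_ge0// ltW.
have powK (b : R) : 0 <= b -> b `^ p `^ p^-1 = b.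
  by move=> b_ge0; rewrite -powRrM mulfV ?gt_eqF// powRr1.
have powVK (b : R) : 0 <= b -> b `^ p^-1 `^ p = b.
  by move=> b_ge0; rewrite -powRrM mulVf ?gt_eqF// powRr1.
(* Solving for c, the hypothesis says (h / k)^(1/p) <= c for every c > a. *)
have : (h / k) `^ p^-1 <= a.
  apply/ler_addgt0Pr => e e_gt0.
  have ae_ge0 : 0 <= a + e by rewrite addr_ge0// ltW.
  rewrite -[leRHS]powK// ge0_ler_powR ?nnegrE ?powR_ge0 ?invr_ge0 ?(ltW p_gt0)//.
  by rewrite ler_pdivrMr// mulrC hc// ltrDl.
move=> /(ge0_ler_powR (ltW p_gt0)); rewrite !nnegrE powR_ge0 a_ge0 => /(_ erefl erefl).
by rewrite powVK// ler_pdivrMr// mulrC.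
Qed.

(* For a, b > 0 write a = g * exp s and b = g * exp t, g being the weighted
   geometric mean; then alpha * s + beta * t = 0 and exp s >= 1 + s. *)
Lemma leif_weighted_AGM (a b : R) : 0 <= a -> 0 <= b ->
  a `^ alpha * b `^ beta <= alpha * a + beta * b ?= iff (a == b).
Proof.
move=> a_ge0 b_ge0.
have alpha_neq0 := lt0r_neq0 alpha_gt0; have beta_neq0 := lt0r_neq0 beta_gt0.
have [->|a_neq0] := eqVneq a 0.
  rewrite powR0// mul0r mulr0 add0r.
  apply/leifP; have [<-|b_neq0] := eqVneq 0 b; first by rewrite mulr0.
  by rewrite mulr_gt0// lt_def b_ge0 eq_sym b_neq0.
have [->|b_neq0] := eqVneq b 0.
  rewrite powR0// !mulr0 addr0.
  apply/leifP; rewrite (negPf a_neq0).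
  by rewrite mulr_gt0// lt_def a_ge0 a_neq0.
have a_gt0 : 0 < a by rewrite lt_def a_neq0.
have b_gt0 : 0 < b by rewrite lt_def b_neq0.
pose g := a `^ alpha * b `^ beta.
have g_gt0 : 0 < g by rewrite mulr_gt0// powR_gt0.
pose s := ln (a / g); pose t := ln (b / g).
have aE : a = g * expR s.
  by rewrite lnK ?posrE ?divr_gt0// mulrC divfK// gt_eqF.
have bE : b = g * expR t.
  by rewrite lnK ?posrE ?divr_gt0// mulrC divfK// gt_eqF.
have st : alpha * s + beta * t = 0.
  rewrite /s /t !ln_div ?posrE// !mulrBr addrACA -opprD -mulrDl alpha_beta mul1r.
  by rewrite /g lnM ?posrE ?powR_gt0// !ln_powR subrr.
have -> : a == b = (s == 0) && (t == 0).
  apply/eqP/andP => [ab|[/eqP s0 /eqP t0]]; last by rewrite aE bE s0 t0.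
  have /eqP : s = t by rewrite /s /t ab.
  rewrite eq_sym => /eqP ts; move: st.
  by rewrite ts -mulrDl alpha_beta mul1r => ->; rewrite eqxx.
have expR_leif (x : R) : 1 + x <= expR x ?= iff (x == 0).
  apply/leifP; have [->|] := eqVneq x 0; first by rewrite addr0 expR0.
  exact: expR_gt1Dx.
suff : 1 <= alpha * expR s + beta * expR t ?= iff (s == 0) && (t == 0).
  by rewrite -(mono_leif (ler_pM2l g_gt0)) mulr1 mulrDr !(mulrCA g) -aE -bE.
have -> : 1 = alpha * (1 + s) + beta * (1 + t).
  by rewrite !mulrDr !mulr1 addrACA st addr0.
by apply: leifD; rewrite (mono_leif (ler_pM2l _)).
Qed.
(** After division by the two totals, the weighted mean inequality applies term by term; the
    right-hand sides add up to alpha + beta = 1, and equality in the sum means equality in every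
    term. *)
Lemma leif_hoelder_sum (I : finType) (a b : I -> R) :
  (forall i, 0 <= a i) -> (forall i, 0 <= b i) ->
  0 < \sum_i a i -> 0 < \sum_i b i ->
  \sum_i a i `^ alpha * b i `^ beta <=
    (\sum_i a i) `^ alpha * (\sum_i b i) `^ beta
    ?= iff [forall i, a i / \sum_k a k == b i / \sum_k b k].
Proof.
set A := \sum_i a i; set B := \sum_i b i => a_ge0 b_ge0 A_gt0 B_gt0.
have AB_gt0 : 0 < A `^ alpha * B `^ beta by rewrite mulr_gt0// powR_gt0.
rewrite -(mono_leif (ler_pM2l (_ : 0 < (A `^ alpha * B `^ beta)^-1))) ?invr_gt0//.
rewrite mulVf ?gt_eqF// mulr_sumr.
have termE i : (A `^ alpha * B `^ beta)^-1 * (a i `^ alpha * b i `^ beta) =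
    (a i / A) `^ alpha * (b i / B) `^ beta.
  rewrite !powRM ?invr_ge0 ?(ltW A_gt0) ?(ltW B_gt0)//.
  rewrite -!powR_inv1 ?powR_ge0 ?(ltW A_gt0) ?(ltW B_gt0) ?(ltW AB_gt0)//.
  rewrite powRM ?powR_ge0// -!powRrM ![_ * -1]mulrC !mulN1r.
  by rewrite mulrC mulrACA.
under eq_bigr do rewrite termE.
have -> : 1 = \sum_i (alpha * (a i / A) + beta * (b i / B)).
  rewrite big_split/= -!mulr_sumr -!mulr_suml.
  by rewrite !divff ?gt_eqF// !mulr1.
by apply: leif_sum => i _; apply: leif_weighted_AGM; rewrite divr_ge0// ltW.
Qed.

(** If a total vanishes then so does its family, and both sides are 0 because the exponents are
    positive. *)
Lemma hoelder_sum (I : finType) (a b : I -> R) :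
  (forall i, 0 <= a i) -> (forall i, 0 <= b i) ->
  \sum_i a i `^ alpha * b i `^ beta <=
    (\sum_i a i) `^ alpha * (\sum_i b i) `^ beta.
Proof.
move=> a_ge0 b_ge0.
have A_ge0 : 0 <= \sum_i a i by exact: sumr_ge0.
have B_ge0 : 0 <= \sum_i b i by exact: sumr_ge0.
have [A0|A_neq0] := eqVneq (\sum_i a i) 0.
  rewrite A0 powR0 ?lt0r_neq0// mul0r big1// => i _.
  have /eqP := A0; rewrite psumr_eq0// => /allP/(_ i (mem_index_enum _))/eqP ->.
  by rewrite powR0 ?lt0r_neq0// mul0r.
have [B0|B_neq0] := eqVneq (\sum_i b i) 0.
  rewrite B0 powR0 ?lt0r_neq0// mulr0 big1// => i _.
  have /eqP := B0; rewrite psumr_eq0// => /allP/(_ i (mem_index_enum _))/eqP ->.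
  by rewrite powR0 ?lt0r_neq0// mulr0.
by apply: leif_hoelder_sum => //; rewrite lt_def ?A_neq0 ?B_neq0.
Qed.

(** * The inequality for the Hadamard mean *)

Section HadamardMean.
Variables (d n : nat) (F G : tensor R d n).
Hypotheses (n_gt0 : (0 < n)%N) (d_gt0 : (0 < d.-1)%N).
Hypotheses (F_ge0 : nonneg_tensor F) (G_ge0 : nonneg_tensor G).

Let H := hadamard (hadamard_pow F alpha) (hadamard_pow G beta).

Definition vec_mean (u v : 'cV[R]_n) : 'cV[R]_n :=
  \col_k (u k 0 `^ alpha * v k 0 `^ beta).

Lemma nonneg_hadamard_mean : nonneg_tensor H.
Proof. by move=> i j; rewrite mulr_ge0 ?powR_ge0. Qed.

Lemma pos_vec_mean u v : pos_vec u -> pos_vec v -> pos_vec (vec_mean u v).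
Proof. by move=> u_gt0 v_gt0 k; rewrite mxE mulr_gt0 ?powR_gt0. Qed.

Lemma tensor_app_hadamard_mean u v i : pos_vec u -> pos_vec v ->
  tensor_app H (vec_mean u v) i 0 = \sum_(j : d.-1.-tuple 'I_n)
    (F i j * \prod_(k < d.-1) u (tnth j k) 0) `^ alpha *
    (G i j * \prod_(k < d.-1) v (tnth j k) 0) `^ beta.
Proof.
move=> u_gt0 v_gt0; rewrite mxE; apply: eq_bigr => j _.
have prod_ge0 (x : 'cV[R]_n) : pos_vec x -> 0 <= \prod_(k < d.-1) x (tnth j k) 0.
  by move=> x_gt0; apply: prodr_ge0 => k _; exact: ltW.
rewrite !powRM ?F_ge0 ?G_ge0 ?prod_ge0// !powR_prod => [|k|k]; try exact: ltW.
rewrite mulrACA -big_split; congr (_ * _).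
by apply: eq_bigr => k _; rewrite mxE.
Qed.

Lemma powR_vec_mean (u v : 'cV[R]_n) c c' i : pos_vec u -> pos_vec v ->
  0 <= c -> 0 <= c' ->
  (c * u i 0 ^+ d.-1) `^ alpha * (c' * v i 0 ^+ d.-1) `^ beta =
  c `^ alpha * c' `^ beta * vec_mean u v i 0 ^+ d.-1.
Proof.
move=> u_gt0 v_gt0 c_ge0 c'_ge0.
have u_ge0 := ltW (u_gt0 i); have v_ge0 := ltW (v_gt0 i).
rewrite mxE exprMn !powRM ?exprn_ge0// -!powR_mulrn ?powR_ge0//.
by rewrite mulrACA ![_ `^ _ `^ d.-1%:R]powRAC.
Qed.

Lemma superharmonic_hadamard_mean c c' :
  superharmonic_values F c -> superharmonic_values G c' ->
  superharmonic_values H (c `^ alpha * c' `^ beta).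
Proof.
move=> Fc Gc'.
have c_ge0 : 0 <= c by have [_] := has_inf_superharmonic_values n_gt0 F_ge0; exact.
have c'_ge0 : 0 <= c' by have [_] := has_inf_superharmonic_values n_gt0 G_ge0; exact.
have [u u_gt0 Fu] := Fc; have [v v_gt0 Gv] := Gc'.
exists (vec_mean u v) => [|i]; first exact: pos_vec_mean.
have u_ge0 k : 0 <= u k 0 by exact: ltW.
have v_ge0 k : 0 <= v k 0 by exact: ltW.
rewrite tensor_app_hadamard_mean// -powR_vec_mean//.
apply: le_trans (hoelder_sum _ _) _ => [j|j|].
- by rewrite mulr_ge0 ?F_ge0 ?prodr_ge0.
- by rewrite mulr_ge0 ?G_ge0 ?prodr_ge0.
have FE : \sum_j F i j * \prod_(k < d.-1) u (tnth j k) 0 = tensor_app F u i 0.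
  by rewrite mxE.
have GE : \sum_j G i j * \prod_(k < d.-1) v (tnth j k) 0 = tensor_app G v i 0.
  by rewrite mxE.
rewrite FE GE.
by apply: ler_pM; rewrite ?powR_ge0// ge0_ler_powR ?nnegrE ?tensor_app_ge0
  ?mulr_ge0 ?exprn_ge0 ?(ltW alpha_gt0) ?(ltW beta_gt0).
Qed.

(** The infima may not be attained, so the bound is first shown for c > rho(F) and c' > rho(G), with
    superharmonic values below them; [ler_powR_limit] then removes the excess in each factor in
    turn. *)
Lemma spectral_radius_hadamard_mean_le :
  spectral_radius H <= spectral_radius F `^ alpha * spectral_radius G `^ beta.
Proof.
have H_ge0 := nonneg_hadamard_mean.
rewrite !spectral_radiusE//.
have F0 := superharmonic_inf_ge0 n_gt0 F_ge0.
have G0 := superharmonic_inf_ge0 n_gt0 G_ge0.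
have ge0_values (T : tensor R d n) c : nonneg_tensor T ->
    superharmonic_inf T < c -> exists2 c1, superharmonic_values T c1 & c1 < c.
  move=> T_ge0; have [[U0 _] _] := has_inf_superharmonic_values n_gt0 T_ge0.
  by move=> /(inf_lt U0)[c1 ? ?]; exists c1.
apply: ler_powR_limit; rewrite ?powR_ge0// => c' Gc'.
rewrite mulrC; apply: ler_powR_limit; rewrite ?powR_ge0// => c Fc.
have [c1 Fc1 c1c] := ge0_values F c F_ge0 Fc.
have [c2 Gc2 c2c'] := ge0_values G c' G_ge0 Gc'.
have c1_ge0 : 0 <= c1 by apply: le_trans F0 _; exact: superharmonic_inf_le.
have c2_ge0 : 0 <= c2 by apply: le_trans G0 _; exact: superharmonic_inf_le.
apply: (@le_trans _ _ (c1 `^ alpha * c2 `^ beta)).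
  by apply: superharmonic_inf_le => //; exact: superharmonic_hadamard_mean.
rewrite mulrC; apply: ler_pM; rewrite ?powR_ge0//.
  by rewrite ge0_ler_powR ?nnegrE ?(ltW beta_gt0) ?(ltW c2c')//
    (le_trans c2_ge0 (ltW c2c')).
by rewrite ge0_ler_powR ?nnegrE ?(ltW alpha_gt0) ?(ltW c1c)//
  (le_trans c1_ge0 (ltW c1c)).
Qed.

(** * The case of equality *)

Section Equality.
Variables u v : 'cV[R]_n.
Hypotheses (u_gt0 : pos_vec u) (v_gt0 : pos_vec v).
Hypothesis Fu : tensor_app F u = spectral_radius F *: vec_pow u d.-1.
Hypothesis Gv : tensor_app G v = spectral_radius G *: vec_pow v d.-1.
Hypothesis H_irr : weakly_irreducible H.

Let p i (j : d.-1.-tuple 'I_n) := F i j * \prod_(k < d.-1) u (tnth j k) 0.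
Let q i (j : d.-1.-tuple 'I_n) := G i j * \prod_(k < d.-1) v (tnth j k) 0.
Let C := spectral_radius F `^ alpha * spectral_radius G `^ beta.
Let w := vec_mean u v.

Let p_ge0 i j : 0 <= p i j.
Proof. by rewrite mulr_ge0 ?F_ge0// prodr_ge0// => k _; exact: ltW. Qed.

Let q_ge0 i j : 0 <= q i j.
Proof. by rewrite mulr_ge0 ?G_ge0// prodr_ge0// => k _; exact: ltW. Qed.

(** A positive entry of H in row i comes from positive entries of F and G, as 0 to a positive power
    is 0. The equality case of Hoelder can then be applied to the row. *)
Let sum_pq_gt0 i : 0 < \sum_j p i j /\ 0 < \sum_j q i j.
Proof.
have [j Hij] := weakly_irreducible_row_neq0 i nonneg_hadamard_mean H_irr.
have Fij : 0 < F i j.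
  rewrite lt_def F_ge0 andbT; apply: contraTneq Hij => F0.
  by rewrite /H /hadamard /hadamard_pow F0 powR0 ?lt0r_neq0// mul0r ltxx.
have Gij : 0 < G i j.
  rewrite lt_def G_ge0 andbT; apply: contraTneq Hij => G0.
  by rewrite /H /hadamard /hadamard_pow G0 powR0 ?lt0r_neq0// mulr0 ltxx.
split; rewrite (bigD1 j)//= ltr_wpDr ?sumr_ge0//.
  by rewrite /p mulr_gt0// prodr_gt0.
by rewrite /q mulr_gt0// prodr_gt0.
Qed.

(** The eigenvalue equations evaluate the row totals as rho(F) u_i^(d-1) and rho(G) v_i^(d-1), which
    turns Hoelder's bound into C w_i^(d-1). *)
Let tensor_app_mean_leif i : tensor_app H w i 0 <= C * w i 0 ^+ d.-1
  ?= iff [forall j, p i j / \sum_k p i k == q i j / \sum_k q i k].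
Proof.
have [P_gt0 Q_gt0] := sum_pq_gt0 i.
have := leif_hoelder_sum (p_ge0 i) (q_ge0 i) P_gt0 Q_gt0.
rewrite -tensor_app_hadamard_mean//.
have -> : \sum_j p i j = spectral_radius F * u i 0 ^+ d.-1.
  by have /matrixP/(_ i 0) := Fu; rewrite !mxE.
have -> : \sum_j q i j = spectral_radius G * v i 0 ^+ d.-1.
  by have /matrixP/(_ i 0) := Gv; rewrite !mxE.
by rewrite powR_vec_mean// spectral_radiusE// superharmonic_inf_ge0.
Qed.

Lemma spectral_radius_hadamard_mean_eq :
  spectral_radius H = C <->
  exists a : 'cV[R]_n, pos_vec a /\
    forall i (j : d.-1.-tuple 'I_n),
      F i j * \prod_(k < d.-1) u (tnth j k) 0
        = a i 0 * G i j * \prod_(k < d.-1) v (tnth j k) 0.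
Proof.
have H_ge0 := nonneg_hadamard_mean.
have w_gt0 : pos_vec w by exact: pos_vec_mean.
split=> [HC|[a [a_gt0 pq]]].
  have [x [x_ge0 x_neq0] Hx] := superharmonic_inf_eigenvector n_gt0 d_gt0 H_ge0.
  have Hw : forall i, tensor_app H w i 0 = C * w i 0 ^+ d.-1.
    apply: (superharmonic_rigidity n_gt0 H_ge0 (proj1 H_irr) w_gt0 _ x_ge0 x_neq0).
      by move=> i; exact: tensor_app_mean_leif.
    by move=> i; rewrite Hx -HC spectral_radiusE.
  (* The factor a_i is the ratio of the row totals, so that equality of the normalised rows reads p
     = a q. *)
  exists (\col_i ((\sum_k p i k) / \sum_k q i k)); split=> [i|i j].
    by rewrite mxE; have [? ?] := sum_pq_gt0 i; rewrite divr_gt0.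
  have [P_gt0 Q_gt0] := sum_pq_gt0 i.
  have [_] := tensor_app_mean_leif i; rewrite Hw eqxx => /esym/forallP/(_ j)/eqP pq.
  rewrite mxE -mulrA -/(p i j) -/(q i j).
  by rewrite mulrAC -mulrA -pq mulrC divfK// gt_eqF.
(* Only C <= rho(H) is left: proportional rows give equality in Hoelder, so w is a positive
   eigenvector for C and C is at most every superharmonic value. *)
apply/eqP; rewrite eq_le spectral_radius_hadamard_mean_le/= spectral_radiusE//.
have w_ge0 k : 0 <= w k 0 by exact: ltW.
have w_neq0 : w != 0.
  apply: contraTneq (w_gt0 (Ordinal n_gt0)) => ->.
  by rewrite mxE ltxx.
have Hw i : tensor_app H w i 0 = C * w i 0 ^+ d.-1.
  have [_] := tensor_app_mean_leif i.
  suff -> : [forall j, p i j / \sum_k p i k == q i j / \sum_k q i k] by move/eqP.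
  have pqE j : p i j = a i 0 * q i j by rewrite /p /q pq mulrA.
  apply/forallP => j; under eq_bigr do rewrite pqE.
  by rewrite -mulr_sumr pqE -mulf_div divff ?mul1r// gt_eqF.
have [[U0 _] _] := has_inf_superharmonic_values n_gt0 H_ge0.
apply: lb_le_inf => // c Hc.
by apply: superharmonic_value_ge Hc w_ge0 w_neq0 _ => // i; rewrite Hw.
Qed.

End Equality.
End HadamardMean.
End WeightedMeans.

Theorem lemma6 (R : realType) (n d : nat) (hn : (1 <= n)%N) (hd : (3 <= d)%N)
  (F G : tensor R d n)
  (F_ge0 : nonneg_tensor F) (F_sym : partially_symmetric F)
  (G_ge0 : nonneg_tensor G) (G_sym : partially_symmetric G)
  (alpha beta : R) (alpha_gt0 : 0 < alpha) (beta_gt0 : 0 < beta)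
  (alpha_beta : alpha + beta = 1) :
  spectral_radius (hadamard (hadamard_pow F alpha) (hadamard_pow G beta))
    <= spectral_radius F `^ alpha * spectral_radius G `^ beta
  /\
  (weakly_irreducible (hadamard (hadamard_pow F alpha) (hadamard_pow G beta)) ->
   forall u v : 'cV[R]_n,
     pos_vec u -> tensor_app F u = spectral_radius F *: vec_pow u d.-1 ->
     pos_vec v -> tensor_app G v = spectral_radius G *: vec_pow v d.-1 ->
     (spectral_radius (hadamard (hadamard_pow F alpha) (hadamard_pow G beta))
        = spectral_radius F `^ alpha * spectral_radius G `^ beta
      <->
      exists a : 'cV[R]_n, pos_vec a /\
        forall (i : 'I_n) (j : d.-1.-tuple 'I_n),
          F i j * \prod_(k < d.-1) u (tnth j k) 0
            = a i 0 * G i j * \prod_(k < d.-1) v (tnth j k) 0)).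
Proof.
have d_gt0 : (0 < d.-1)%N by case: d hd {F G F_ge0 F_sym G_ge0 G_sym} => [|[]].
split; first exact: spectral_radius_hadamard_mean_le.
by move=> H_irr u v u_gt0 Fu v_gt0 Gv; exact: spectral_radius_hadamard_mean_eq.
Qed.
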